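(* Assume that $(A_1)$ holds, that is, $I_n-A(t)$ and $I_n-D(t)$ are invertible for all $t\in\mathcal{I}$. Then $H_2=H_{1,0}^*$ and $H_1=H_{2,0}^*$, and consequently $\{H_{1,0},H_{2,0}\}$ is a dual pair.
   Context: Setting. $\mathcal{I}=\{t\}_{t=a}^{b}$ is an integer interval, $a$ a finite integer or $-\infty$, $b$ a finite integer or $+\infty$, $b-a\ge 1$ ($b+1$ means $+\infty$ if $b=+\infty$). $J=\begin{pmatrix}0&-I_n\\ I_n&0\end{pmatrix}$, $\Delta y(t)=y(t+1)-y(t)$, $l(\mathcal{I})=\{y=\{y(t)\}_{t=a}^{b+1}\subset\mathbb{C}^{2n}\}$, and for $y(t)=(u^T(t),v^T(t))^T$ with $u(t),v(t)\in\mathbb{C}^n$, $R(y)(t)=(u^T(t+1),v^T(t))^T$. $W(t)=\mathrm{diag}\{W_1(t),W_2(t)\}$ with $W_j(t)\ge0$ Hermitian $n\times n$; $P(t)=\begin{pmatrix}-C(t)&D(t)\\ A(t)&B(t)\end{pmatrix}$ with $A,B,C,D$ complex $n\times n$ matrix functions on $\mathcal{I}$ ($P$ need not be Hermitian). Define $(\mathscr{L}_1y)(t)=J\Delta y(t)-P(t)R(y)(t)$ and $(\mathscr{L}_2y)(t)=J\Delta y(t)-P^*(t)R(y)(t)$, $t\in\mathcal{I}$. Spaces. $l^2_W(\mathcal{I})=\{y\in l(\mathcal{I}):\sum_{t\in\mathcal{I}}R(y)^*(t)W(t)R(y)(t)<\infty\}$, $\langle y,z\rangle=\sum_{t\in\mathcal{I}}R(z)^*(t)W(t)R(y)(t)$,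 $\|y\|=\langle y,y\rangle^{1/2}$, and $L^2_W(\mathcal{I})=l^2_W(\mathcal{I})/\{y:\|y\|=0\}$ (a Hilbert space), with $[y]$ the class of $y$. $l^2_{W,0}(\mathcal{I})$ is the set of $y\in l^2_W(\mathcal{I})$ for which there are $s,k\in\mathcal{I}$ with $y(t)=0$ for $t\le s$ and for $t\ge k+1$. Linear relations. A linear relation in a Hilbert space $X$ is a linear subspace $T$ of $X^2$; $T^*=\{(y,g)\in X^2:\langle y,f\rangle=\langle g,x\rangle\ \forall(x,f)\in T\}$. Closed linear relations $T,S$ form a dual pair $\{T,S\}$ if $\langle f,y\rangle=\langle x,g\rangle$ for all $(x,f)\in T$, $(y,g)\in S$, equivalently $T\subset S^*$. For $i=1,2$, $H_i=\{([y],[g])\in(L^2_W(\mathcal{I}))^2:\exists y\in[y],\ (\mathscr{L}_iy)(t)=W(t)R(g)(t),\ t\in\mathcal{I}\}$ (maximal), $H_{i,00}=\{([y],[g])\in H_i:\exists y\in[y]\cap l^2_{W,0}(\mathcal{I}),\ (\mathscr{L}_iy)(t)=W(t)R(g)(t),\ t\in\mathcal{I}\}$, $H_{i,0}=\overline{H_{i,00}}$ (minimal). *)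

(* Defs.v *)
From HB Require Import structures.
From mathcomp Require Import all_boot all_order all_algebra.
From mathcomp Require Import spectral sesquilinear ring_quotient generic_quotient.
From mathcomp Require Import complex ring lra.
From mathcomp Require Import mathcomp_extra boolp classical_sets functions reals.
From mathcomp Require Import constructive_ereal ereal topology normedtype esum numfun.

Set Implicit Arguments.
Unset Strict Implicit.
Unset Printing Implicit Defensive.

Import Order.TTheory GRing.Theory Num.Theory numFieldNormedType.Exports.
Import Quotient.Exports.

Local Open Scope classical_set_scope.
Local Open Scope ring_scope.
Local Open Scope sesquilinear_scope.
Local Open Scope quotient_scope.

Section SemiInnerProduct.
Variables (K : numClosedFieldType) (U : lmodType K) (f : U -> U -> K).
Hypothesis f_lin : forall c u v w, f (c *: u + v) w = c * f u w + f v w.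
Hypothesis f_herm : forall u v, f u v = (f v u)^*.
Hypothesis f_ge0 : forall u, 0 <= f u u.

Lemma semiip_linr c u v w : f u (c *: v + w) = c^* * f u v + f u w.
Proof. by rewrite f_herm f_lin rmorphD rmorphM /= -!f_herm. Qed.

Lemma semiip0l u : f 0 u = 0.
Proof. by have := f_lin (-1) u u u; rewrite scaleN1r addNr mulN1r addNr. Qed.

Lemma semiip0r u : f u 0 = 0.
Proof. by rewrite f_herm semiip0l rmorph0. Qed.

Lemma semiip_sqr c u v :
  f (c *: u + v) (c *: u + v) = `|c| ^+ 2 * f u u + c * f u v + (c * f u v)^* + f v v.
Proof.
rewrite f_lin !semiip_linr normCK rmorphM /= -f_herm mulrDr !mulrA.
by rewrite !addrA.
Qed.

Lemma semiip_CS u v : `|f u v| ^+ 2 <= f u u * f v v.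
Proof.
have [uv0|uv0] := eqVneq (f u v) 0.
  by rewrite uv0 normr0 expr0n mulr_ge0.
have n0 : 0 < `|f u v| by rewrite normr_gt0.
have key (r : K) : r \is Num.real ->
    0 <= r ^+ 2 * f u u - (r * `|f u v|) *+ 2 + f v v.
  move=> rR; pose c := - (r * (f u v)^* / `|f u v|).
  have cf : c * f u v = - (r * `|f u v|).
    rewrite /c mulNr; congr (- _).
    have -> : r * (f u v)^* / `|f u v| * f u v = r * (f u v * (f u v)^*) / `|f u v|.
      by ring.
    by rewrite -normCK expr2 mulrA mulfK // lt0r_neq0.
  have cn : `|c| ^+ 2 = r ^+ 2.
    rewrite /c normrN normf_div normrM norm_conjC normr_id mulfK ?lt0r_neq0 //.
    by rewrite real_normK.
  have := f_ge0 (c *: u + v); rewrite semiip_sqr cf cn rmorphN rmorphM /=.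
  rewrite (conj_Creal (normr_real _)) (conj_Creal rR).
  by rewrite mulr2n opprD !addrA.
have [u0|u0] := eqVneq (f u u) 0.
  have := key ((f v v + 1) / (`|f u v| *+ 2)).
  have -> : (f v v + 1) / (`|f u v| *+ 2) \is Num.real.
    by rewrite ger0_real // divr_ge0 ?addr_ge0 // mulrn_wge0.
  move=> /(_ isT); rewrite u0 mulr0 add0r -mulrnAr divfK; last first.
    by rewrite mulrn_eq0 negb_or /= lt0r_neq0.
  by rewrite opprD addrAC addNr add0r oppr_ge0 ler10.
have up : 0 < f u u by rewrite lt_def u0 f_ge0.
have := key (`|f u v| / f u u).
have -> : `|f u v| / f u u \is Num.real by rewrite ger0_real // divr_ge0.
move=> /(_ isT).
rewrite exprMn [_^-1 ^+ 2]expr2 -!mulrA mulVf // mulr1.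
rewrite [(f u u)^-1 * _]mulrC !mulrA -expr2 mulr2n opprD addrA subrr add0r.
by rewrite addrC subr_ge0 ler_pdivrMr // mulrC.
Qed.

Lemma semiip_null u v : f u u = 0 -> f u v = 0.
Proof.
move=> u0; have := semiip_CS u v; rewrite u0 mul0r => h.
by apply/eqP; rewrite -normr_eq0 -sqrf_eq0 eq_le h exprn_ge0.
Qed.

Lemma semiip_normZ c u : sqrtC (f (c *: u) (c *: u)) = `|c| * sqrtC (f u u).
Proof.
rewrite -[c *: u]addr0 semiip_sqr !semiip0r !mulr0 rmorph0 !addr0.
by rewrite sqrtCM ?nnegrE ?exprn_ge0 // sqrCK.
Qed.

Lemma semiip_triangle u v :
  sqrtC (f (u + v) (u + v)) <= sqrtC (f u u) + sqrtC (f v v).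
Proof.
have n0 x : 0 <= sqrtC (f x x) by rewrite sqrtC_ge0.
have CS : `|f u v| <= sqrtC (f u u) * sqrtC (f v v).
  by rewrite -ler_sqr ?nnegrE ?mulr_ge0 // exprMn !sqrtCK semiip_CS.
rewrite -ler_sqr ?nnegrE ?addr_ge0 // sqrrD !sqrtCK.
have := semiip_sqr 1 u v; rewrite scale1r normr1 expr1n !mul1r => ->.
rewrite lerD2r -addrA lerD2l mulr2n.
apply: le_trans (_ : `|f u v| + `|f u v| <= _); last exact: lerD.
rewrite -[in X in _ <= _ + X]norm_conjC.
apply: le_trans (real_ler_norm _) (ler_normD _ _).
by rewrite CrealE rmorphD /= conjCK addrC.
Qed.

End SemiInnerProduct.


Local Open Scope complex_scope.
Local Open Scope ring_scope.

(* Unconditional sum of a real family; meaningful for summable families. *)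
HB.lock Definition rsum (R : realType) (T : choiceType) (I : set T) (f : T -> R) : R :=
  fine (esum I (EFin \o f)^\+ - esum I (EFin \o f)^\-)%E.

Section UnconditionalSums.
Variables (R : realType) (T : choiceType) (I : set T).
Implicit Types f g : T -> R.
Local Notation rsum := (rsum I).
Local Open Scope ereal_scope.

Definition rsummable f := summable I (EFin \o f).

Lemma rsummable_le f g :
  (forall t, I t -> (`|f t| <= g t)%R) -> rsummable g -> rsummable f.
Proof.
move=> fg; apply: le_lt_trans; apply: le_esum => t It /=.
by rewrite lee_fin (le_trans (fg _ It)) // ler_norm.
Qed.

Lemma rsummableD f g :
  rsummable f -> rsummable g -> rsummable (fun t => f t + g t)%R.
Proof. exact: summableD. Qed.

Lemma esumZl (c : R) (f : T -> \bar R) : (0 <= c)%R -> (forall t, 0 <= f t) ->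
  \esum_(t in I) (c%:E * f t) = c%:E * \esum_(t in I) f t.
Proof.
have le_ (d : R) (g : T -> \bar R) : (0 <= d)%R -> (forall t, 0 <= g t) ->
    \esum_(t in I) (d%:E * g t) <= d%:E * \esum_(t in I) g t.
  move=> d0 g0; apply: ge_ereal_sup => _ [F FI <-].
  rewrite -ge0_mule_fsumr //; apply: lee_wpmul2l; first by rewrite lee_fin.
  by apply: ereal_sup_ubound; exists F.
move=> c0 f0; apply/eqP; rewrite eq_le le_ //=.
have [->|cn0] := eqVneq c 0%R.
  by rewrite mul0e; apply: esum_ge0 => t _; rewrite mul0e.
have cp : (0 < c)%R by rewrite lt_def cn0.
rewrite -[leRHS]mul1e -(divff cn0) EFinM -muleA; apply: lee_wpmul2l.
  by rewrite lee_fin.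
apply: le_trans (le_ _ _ _ _); last 2 first.
- by rewrite invr_ge0.
- by move=> t; rewrite mule_ge0 // lee_fin.
by apply: le_esum => t _; rewrite muleA -EFinM mulVf // mul1e.
Qed.

Lemma rsummableZ (c : R) f : rsummable f -> rsummable (fun t => c * f t)%R.
Proof.
rewrite /rsummable /summable => fs.
under eq_esum do rewrite /= normrM EFinM.
rewrite esumZl ?normr_ge0 // lte_mul_pinfty //.
Qed.

Lemma esum_fin f : rsummable f -> (forall t, I t -> (0 <= f t)%R) ->
  esum I (EFin \o f) \is a fin_num.
Proof.
rewrite /rsummable summableE => + f0.
by rewrite (@eq_esum _ _ _ _ (EFin \o f)) // => t It /=; rewrite ger0_norm ?f0.
Qed.

Lemma rsumB f g : rsummable f -> rsummable g ->
  (forall t, I t -> (0 <= f t)%R) -> (forall t, I t -> (0 <= g t)%R) ->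
  rsum (fun t => f t - g t)%R =
  (fine (esum I (EFin \o f)) - fine (esum I (EFin \o g)))%R.
Proof.
move=> fs gs f0 g0.
rewrite rsum.unlock -fineB ?esum_fin //; congr fine.
by rewrite -(@esumB _ _ I (EFin \o f) (EFin \o g)) // => t It; rewrite lee_fin ?f0 ?g0.
Qed.

Lemma rsum_pos f : rsummable f -> (forall t, I t -> (0 <= f t)%R) ->
  rsum f = fine (esum I (EFin \o f)).
Proof.
move=> fs f0.
have s0 : rsummable (fun=> 0%R) by apply: rsummable_le fs => t It; rewrite normr0 f0.
have := rsumB fs s0 f0 (fun _ _ => lexx _).
rewrite (_ : esum I (EFin \o (fun=> 0%R)) = 0) ?subr0; last by rewrite esum1.
by under [X in rsum X]funext do rewrite subr0.
Qed.

Lemma eq_rsum f g : (forall t, I t -> f t = g t) -> rsum f = rsum g.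
Proof.
move=> fg; rewrite rsum.unlock; congr (fine (_ - _)); apply: eq_esum => t It.
  by rewrite !funeposE /= fg.
by rewrite !funenegE /= fg.
Qed.

Lemma rsumD f g : rsummable f -> rsummable g ->
  rsum (fun t => f t + g t)%R = (rsum f + rsum g)%R.
Proof.
move=> fs gs.
pose p (h : T -> R) t := Num.max (h t) 0%R.
pose m (h : T -> R) t := Num.max (- h t)%R 0%R.
have p0 h t : I t -> (0 <= p h t)%R by rewrite /p le_max lexx orbT.
have m0 h t : I t -> (0 <= m h t)%R by rewrite /m le_max lexx orbT.
have pm h t : h t = (p h t - m h t)%R.
  rewrite /p /m; have [h0|/ltW h0] := leP 0%R (h t).
    by rewrite max_r ?subr0 // oppr_le0.
  by rewrite max_l ?oppr_ge0 // sub0r opprK.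
have ps h : rsummable h -> rsummable (p h).
  move=> hs; apply: (@rsummable_le _ (fun t => `|h t|)%R).
    by move=> t It; rewrite ger0_norm ?p0 // /p ge_max normr_ge0 ler_norm.
  by move: hs; rewrite /rsummable /summable; under eq_esum do rewrite /= -normr_id.
have ms h : rsummable h -> rsummable (m h).
  move=> hs; apply: (@rsummable_le _ (fun t => `|h t|)%R).
    by move=> t It; rewrite ger0_norm ?m0 // /m ge_max normr_ge0 -normrN ler_norm.
  by move: hs; rewrite /rsummable /summable; under eq_esum do rewrite /= -normr_id.
have E h : rsummable h -> rsum h = (rsum (p h) - rsum (m h))%R.
  move=> hs; rewrite (@eq_rsum h (fun t => p h t - m h t)%R) //.
  by rewrite (rsum_pos (ps _ hs) (@p0 h)) (rsum_pos (ms _ hs) (@m0 h)) rsumB //; auto.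
have D (h k : T -> R) : rsummable h -> rsummable k ->
    (forall t, I t -> (0 <= h t)%R) -> (forall t, I t -> (0 <= k t)%R) ->
    fine (esum I (EFin \o (fun t => h t + k t)%R)) =
    (fine (esum I (EFin \o h)) + fine (esum I (EFin \o k)))%R.
  move=> hs ks h0 k0; rewrite -fineD ?esum_fin // -esumD //.
have -> : rsum (fun t => f t + g t)%R = rsum (fun t => (p f t + p g t) - (m f t + m g t))%R.
  by apply: eq_rsum => t _; rewrite [in LHS](pm f t) [in LHS](pm g t); ring.
have [pf pg mf mg] := And4 (ps _ fs) (ps _ gs) (ms _ fs) (ms _ gs).
have pp t : I t -> (0 <= p f t + p g t)%R by move=> It; rewrite addr_ge0 ?p0.
have mm t : I t -> (0 <= m f t + m g t)%R by move=> It; rewrite addr_ge0 ?m0.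
rewrite (rsumB (rsummableD pf pg) (rsummableD mf mg) pp mm).
rewrite (D _ _ pf pg (@p0 f) (@p0 g)) (D _ _ mf mg (@m0 f) (@m0 g)).
rewrite (E f fs) (E g gs) (rsum_pos pf (@p0 f)) (rsum_pos pg (@p0 g)).
rewrite (rsum_pos mf (@m0 f)) (rsum_pos mg (@m0 g)).
by ring.
Qed.

Lemma rsumN f : rsummable f -> rsum (fun t => - f t)%R = (- rsum f)%R.
Proof.
move=> fs.
have ns : rsummable (fun t => - f t)%R.
  by move: fs; rewrite /rsummable summableN.
apply/eqP; rewrite -addr_eq0 addrC -rsumD //; apply/eqP.
have -> : rsum (fun t => f t + - f t)%R = rsum (fun=> 0%R).
  by apply: eq_rsum => t _; rewrite subrr.
have s0 : rsummable (fun=> 0%R).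
  by rewrite /rsummable /summable esum1 // => t _; rewrite /= normr0.
by rewrite (rsum_pos s0) // esum1.
Qed.

Lemma rsumZ (c : R) f : rsummable f ->
  rsum (fun t => c * f t)%R = (c * rsum f)%R.
Proof.
wlog c0 : c / (0 <= c)%R => [H fs|fs].
  have [/H->//|c0] := leP 0%R c.
  have c0' : (0 <= - c)%R by rewrite oppr_ge0 ltW.
  rewrite -[RHS]opprK -mulNr -H // -rsumN; last exact: rsummableZ.
  by apply: eq_rsum => t _; rewrite mulNr opprK.
have fin (h : T -> \bar R) : summable I h -> esum I h^\+ \is a fin_num /\ esum I h^\- \is a fin_num.
  move=> hs; split.
    move: (summable_funepos hs); rewrite summableE.
    by rewrite (@eq_esum _ _ _ _ h^\+) // => t _; rewrite gee0_abs.
  move: (summable_funeneg hs); rewrite summableE.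
  by rewrite (@eq_esum _ _ _ _ h^\-) // => t _; rewrite gee0_abs.
have [p q] := fin _ fs.
rewrite rsum.unlock (ge0_funeposM (EFin \o f) c0) (ge0_funenegM (EFin \o f) c0).
rewrite !esumZl // -muleBr //; last by rewrite fin_num_adde_defl // fin_numN.
by rewrite fineM // fin_numB p q.
Qed.

End UnconditionalSums.

Section ComplexSums.
Variables (R : realType) (T : choiceType) (I : set T).
Implicit Types f g : T -> R[i].

Definition csummable f :=
  rsummable I (fun t => complex.Re (f t)) /\ rsummable I (fun t => complex.Im (f t)).

Definition csum f : R[i] :=
  rsum I (fun t => complex.Re (f t)) +i* rsum I (fun t => complex.Im (f t)).

Lemma eq_csum f g : (forall t, I t -> f t = g t) -> csum f = csum g.
Proof. by move=> fg; congr (_ +i* _); apply: eq_rsum => t It; rewrite fg. Qed.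

Lemma eq_rsummable (f g : T -> R) : (forall t, I t -> f t = g t) ->
  rsummable I f -> rsummable I g.
Proof.
move=> fg; rewrite /rsummable /summable.
by rewrite (@eq_esum _ _ _ _ (abse \o (EFin \o g))) // => t It /=; rewrite fg.
Qed.

Lemma csummable_conj f : csummable f -> csummable (fun t => (f t)^*).
Proof.
move=> [fr fi]; split.
  by apply: eq_rsummable fr => t _; case: (f t).
apply: (@eq_rsummable (fun t => -1 * complex.Im (f t))); last exact: rsummableZ.
by move=> t _; case: (f t) => x y /=; rewrite mulN1r.
Qed.

Lemma csummableD f g : csummable f -> csummable g -> csummable (fun t => f t + g t).
Proof.
move=> [fr fi] [gr gi]; split.
  by under eq_fun do rewrite raddfD; exact: rsummableD.
by under eq_fun do rewrite raddfD; exact: rsummableD.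
Qed.

Lemma ReM (x y : R[i]) :
  complex.Re (x * y) = complex.Re x * complex.Re y + - complex.Im x * complex.Im y.
Proof. by case: x y => [? ?] [? ?] /=; rewrite mulNr. Qed.

Lemma ImM (x y : R[i]) :
  complex.Im (x * y) = complex.Re x * complex.Im y + complex.Im x * complex.Re y.
Proof. by case: x y => [? ?] [? ?]. Qed.

Lemma csummableZ c f : csummable f -> csummable (fun t => c * f t).
Proof.
move=> [fr fi]; split.
  by under eq_fun do rewrite ReM; apply: rsummableD; exact: rsummableZ.
by under eq_fun do rewrite ImM; apply: rsummableD; exact: rsummableZ.
Qed.

Lemma csumD f g : csummable f -> csummable g ->
  csum (fun t => f t + g t) = csum f + csum g.
Proof.
move=> [fr fi] [gr gi]; rewrite /csum.
under [X in X +i* _]eq_rsum do rewrite raddfD.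
under [X in _ +i* X]eq_rsum do rewrite raddfD.
by rewrite !rsumD.
Qed.

Lemma csumZ c f : csummable f -> csum (fun t => c * f t) = c * csum f.
Proof.
move=> [fr fi]; rewrite /csum.
under [X in X +i* _]eq_rsum do rewrite ReM.
under [X in _ +i* X]eq_rsum do rewrite ImM.
rewrite !rsumD ?rsumZ //; try exact: rsummableZ.
by case: c => c d; rewrite /= mulNr; congr (_ +i* _).
Qed.

Lemma csum_conj f : csummable f -> csum (fun t => (f t)^*) = (csum f)^*.
Proof.
move=> [fr fi]; rewrite /csum /=; congr (_ +i* _).
  by apply: eq_rsum => t _; case: (f t).
by rewrite -rsumN //; apply: eq_rsum => t _; case: (f t).
Qed.

End ComplexSums.

Definition zint (a b : \bar int) : set int := [set t | (a <= t%:E <= b)%E].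

Definition psdmx (R : realType) n (M : 'M[R[i]]_n) :=
  M \is hermsymmx /\ forall x : 'cV_n, 0 <= (x^t* *m M *m x) 0 0.

Record weight (R : realType) (n : nat) (a b : \bar int) := Weight {
  weight1 : int -> 'M[R[i]]_n;
  weight2 : int -> 'M[R[i]]_n;
  weight1_psd : forall t, zint a b t -> psdmx (weight1 t);
  weight2_psd : forall t, zint a b t -> psdmx (weight2 t) }.

Section WeightedSpace.
Variables (R : realType) (n : nat) (a b : \bar int) (w : weight R n a b).
Local Notation I := (zint a b).
Local Notation seqs := (int -> 'cV[R[i]]_(n + n)).

(* The partial shift: if y = (u, v) then its value at t is (u(t+1), v(t)). *)
Definition pshift (y : seqs) (t : int) : 'cV[R[i]]_(n + n) :=
  col_mx (usubmx (y (t + 1))) (dsubmx (y t)).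

Definition weightmx (t : int) : 'M[R[i]]_(n + n) :=
  block_mx (weight1 w t) 0 0 (weight2 w t).

Definition wform (y z : seqs) (t : int) : R[i] :=
  ((pshift z t)^t* *m weightmx t *m pshift y t) 0 0.

Lemma pshift_lin c y z t : pshift (c *: y + z) t = c *: pshift y t + pshift z t.
Proof. by rewrite /pshift scale_col_mx add_col_mx -!linearP. Qed.

Lemma wform_lin t c u v z : wform (c *: u + v) z t = c * wform u z t + wform v z t.
Proof. by rewrite /wform pshift_lin linearP /= !mxE. Qed.

Lemma trmxCE m p q (M : 'M[R[i]]_(m, p)) (N : 'M_(p, q)) :
  (M *m N)^t* = N^t* *m M^t*.
Proof. by rewrite trmx_mul map_mxM. Qed.

Lemma weightmx_herm t : I t -> (weightmx t)^t* = weightmx t.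
Proof.
move=> It; have [/is_hermitianmxP h1 _] := weight1_psd w It.
have [/is_hermitianmxP h2 _] := weight2_psd w It.
rewrite /weightmx tr_block_mx map_block_mx !trmx0 !map_mx0.
by rewrite {2}h1 {2}h2 expr0 !scale1r.
Qed.

Lemma wform_herm t y z : I t -> wform y z t = (wform z y t)^*.
Proof.
move=> It; rewrite /wform.
have E (M : 'M[R[i]]_1) : (M 0 0)^* = M^t* 0 0 by rewrite !mxE.
by rewrite [RHS]E !trmxCE trmxCK weightmx_herm // mulmxA.
Qed.

Lemma wform_ge0 t y : I t -> 0 <= wform y y t.
Proof.
move=> It; have [_ h1] := weight1_psd w It; have [_ h2] := weight2_psd w It.
rewrite /wform /pshift /weightmx tr_col_mx map_row_mx mul_row_block !mulmx0.
by rewrite addr0 add0r mul_row_col mxE addr_ge0.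
Qed.

(* A sequence on {a, ..., b + 1} is represented by a function on int: its values
   outside {a, ..., b + 1} are irrelevant (wform only reads values inside), and
   they disappear in the quotient L2 below.  By wform_ge0 the terms are
   nonnegative reals, so taking the real part only changes their type. *)
Definition l2W : {pred seqs} :=
  [pred y | (\esum_(t in I) (complex.Re (wform y y t))%:E < +oo)%E].

Lemma l2WE y : (y \in l2W) <-> rsummable I (fun t => complex.Re (wform y y t)).
Proof.
rewrite inE /rsummable /summable /= (@eq_esum _ _ _ _ (abse \o (EFin \o (fun t => complex.Re (wform y y t))))) //.
move=> t It /=; rewrite ger0_norm //.
by have := wform_ge0 y It; rewrite lecE => /andP[].
Qed.

Lemma wform_im0 t y : I t -> complex.Im (wform y y t) = 0.
Proof. by move=> It; have := wform_ge0 y It; rewrite lecE => /andP[/eqP]. Qed.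

Lemma wform_bound t y z : I t ->
  `|complex.Re (wform y z t)| <= complex.Re (wform y y t) + complex.Re (wform z z t) /\
  `|complex.Im (wform y z t)| <= complex.Re (wform y y t) + complex.Re (wform z z t).
Proof.
move=> It.
have lin c u v x : wform (c *: u + v) x t = c * wform u x t + wform v x t.
  exact: wform_lin.
have key (c : R[i]) := semiip_sqr lin (fun u v => wform_herm u v It) c y z.
have pos (c : R[i]) : `|c| ^+ 2 = 1 -> 0 <= wform y y t + c * wform y z t
                   + (c * wform y z t)^* + wform z z t.
  by move=> c1; rewrite -[wform y y t]mul1r -c1 -key wform_ge0.
have pre : forall u, 0 <= complex.Re (wform u u t).
  by move=> u; have := wform_ge0 u It; rewrite lecE => /andP[].
have ni : `|'i%C : R[i]| ^+ 2 = 1.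
  by rewrite normCK; simpc.
have n1 : `|1 : R[i]| ^+ 2 = 1 by rewrite normr1 expr1n.
have nN (c : R[i]) : `|c| ^+ 2 = 1 -> `|- c| ^+ 2 = 1 by rewrite normrN.
move: (pre y) (pre z) (pos _ n1) (pos _ (nN _ n1)) (pos _ ni) (pos _ (nN _ ni)).
rewrite !lecE.
case: (wform y y t) (wform z z t) (wform y z t) => [p p'] [q q'] [r r'] /=.
move=> p0 q0 /andP[_ h1] /andP[_ h2] /andP[_ h3] /andP[_ h4].
by split; rewrite ler_norml; apply/andP; split; lra.
Qed.

Lemma csummable_wform y z : y \in l2W -> z \in l2W -> csummable I (wform y z).
Proof.
move=> /l2WE ys /l2WE zs; split.
  apply: rsummable_le (rsummableD ys zs) => t It.
  by have [] := wform_bound y z It.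
apply: rsummable_le (rsummableD ys zs) => t It.
by have [] := wform_bound y z It.
Qed.

Lemma l2W_submod : GRing.submod_closed l2W.
Proof.
split=> [|c y z].
  rewrite inE /= esum1 // => t _; rewrite /wform /pshift.
  by rewrite linear0 linear0 col_mx0 mulmx0 mxE.
move=> ys zs; apply/l2WE.
have yz := csummable_wform ys zs; have yy := csummable_wform ys ys.
have := csummableD (csummableD (csummableD (csummableZ (`|c| ^+ 2) yy)
  (csummableZ c yz)) (csummable_conj (csummableZ c yz))) (csummable_wform zs zs).
move=> [+ _]; apply: eq_rsummable => t It; congr complex.Re; symmetry.
apply: (@semiip_sqr _ _ (fun u v => wform u v t)) => [d u v x|u v].
  exact: wform_lin.
exact: wform_herm.
Qed.

HB.instance Definition _ := GRing.isSubmodClosed.Build _ _ l2W l2W_submod.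

Definition l2 := {y : seqs | y \in l2W}.
HB.instance Definition _ := SubChoice.on l2.
HB.instance Definition _ := [SubChoice_isSubLmodule of l2 by <:].

Definition l2ip (y z : l2) : R[i] := csum I (wform (val y) (val z)).

Lemma l2ip_lin c u v z : l2ip (c *: u + v) z = c * l2ip u z + l2ip v z.
Proof.
have [us vs zs] := And3 (valP u) (valP v) (valP z).
have uz := csummable_wform us zs; have vz := csummable_wform vs zs.
rewrite /l2ip -(csumZ c uz) -(csumD (csummableZ c uz) vz).
by apply: eq_csum => t It; exact: wform_lin.
Qed.

Lemma l2ip_herm y z : l2ip y z = (l2ip z y)^*.
Proof.
rewrite /l2ip -(csum_conj (csummable_wform (valP z) (valP y))).
by apply: eq_csum => t It; exact: wform_herm.
Qed.

Lemma l2ip_ge0 y : 0 <= l2ip y y.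
Proof.
have [ys _] := csummable_wform (valP y) (valP y).
have pos t : I t -> 0 <= complex.Re (wform (val y) (val y) t).
  by move=> It; have := wform_ge0 (val y) It; rewrite lecE => /andP[].
rewrite lecE /=; apply/andP; split; last first.
  rewrite rsum_pos // fine_ge0 // esum_ge0 // => t It; rewrite lee_fin; exact: pos.
rewrite (@eq_rsum _ _ _ _ (fun=> 0)) => [|t It]; last exact: wform_im0.
rewrite rsum_pos //; first by rewrite esum1.
by apply: rsummable_le ys => t It; rewrite normr0 pos.
Qed.

Definition l2null : {pred l2} := [pred y | l2ip y y == 0].

Lemma l2null_ip y z : y \in l2null -> l2ip y z = 0.
Proof.
by move=> /eqP; apply: semiip_null; [exact: l2ip_lin|exact: l2ip_herm|exact: l2ip_ge0].
Qed.

Lemma l2null_submod : GRing.submod_closed l2null.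
Proof.
split=> [|c y z yN zN]; first by rewrite inE (semiip0l l2ip_lin).
have hy x := l2null_ip x yN.
have hz x := l2null_ip x zN.
rewrite unfold_in /=; apply/eqP.
rewrite (l2ip_lin c y z) hy hz mulr0 addr0.
by [].
Qed.

HB.instance Definition _ := GRing.isSubmodClosed.Build _ _ l2null l2null_submod.

Definition L2 := Quotient.quot l2null.
HB.instance Definition _ := GRing.Zmodule.on L2.
HB.instance Definition _ := EqQuotient.on L2.

Definition L2cls (y : l2) : L2 := \pi y.

Definition L2ip (Y Z : L2) : R[i] := l2ip (repr Y) (repr Z).

Lemma L2clsP y z : L2cls y = L2cls z <-> l2ip (y - z) (y - z) = 0.
Proof.
split=> [/eqP|yz].
  by rewrite /L2cls -Quotient.idealrBE => /eqP.
by apply/eqP; rewrite /L2cls -Quotient.idealrBE; apply/eqP.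
Qed.

Lemma L2cls_repr Y : L2cls (repr Y) = Y.
Proof. exact: reprK. Qed.

Lemma L2clsD y z : L2cls (y + z) = L2cls y + L2cls z.
Proof. exact: Quotient.pi_add. Qed.

Lemma L2cls0 : L2cls 0 = 0.
Proof. by apply: (@addrI _ (L2cls 0)); rewrite -L2clsD !addr0. Qed.

Lemma l2ip_clsl y y' z : L2cls y = L2cls y' -> l2ip y z = l2ip y' z.
Proof.
move=> /L2clsP yN; have := l2ip_lin 1 (y - y') y' z.
by rewrite scale1r subrK mul1r (@l2null_ip (y - y') z (introT eqP yN)) add0r.
Qed.

Lemma L2ip_cls y z : L2ip (L2cls y) (L2cls z) = l2ip y z.
Proof.
rewrite /L2ip (l2ip_clsl _ (L2cls_repr (L2cls y))) l2ip_herm.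
by rewrite (l2ip_clsl _ (L2cls_repr (L2cls z))) -l2ip_herm.
Qed.

Definition L2scale (c : R[i]) (Y : L2) : L2 := L2cls (c *: repr Y).

Lemma L2clsZ c y : L2cls (c *: y) = L2scale c (L2cls y).
Proof.
apply/L2clsP; rewrite -scalerBr.
set x := y - _; rewrite -[in X in l2ip X _](addr0 (c *: x)) l2ip_lin (semiip0l l2ip_lin) addr0.
have /L2clsP yN := esym (L2cls_repr (L2cls y)).
by rewrite (@l2null_ip x _ (introT eqP yN)) mulr0.
Qed.

Fact L2scaleA c d Y : L2scale c (L2scale d Y) = L2scale (c * d) Y.
Proof. by rewrite -(L2cls_repr Y) -!L2clsZ scalerA. Qed.

Fact L2scale1 : left_id 1 L2scale.
Proof. by move=> Y; rewrite -(L2cls_repr Y) -!L2clsZ scale1r. Qed.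

Fact L2scaleDr : right_distributive L2scale +%R.
Proof.
move=> c Y Z; rewrite -(L2cls_repr Y) -(L2cls_repr Z).
by rewrite -L2clsD -!L2clsZ -L2clsD scalerDr.
Qed.

Fact L2scaleDl Y : {morph L2scale^~ Y : c d / c + d}.
Proof. by move=> c d /=; rewrite -(L2cls_repr Y) -!L2clsZ -L2clsD scalerDl. Qed.

HB.instance Definition _ :=
  GRing.Zmodule_isLmodule.Build R[i] L2 L2scaleA L2scale1 L2scaleDr L2scaleDl.

Lemma L2ip_lin c Y Z X : L2ip (c *: Y + Z) X = c * L2ip Y X + L2ip Z X.
Proof.
rewrite -(L2cls_repr Y) -(L2cls_repr Z) -(L2cls_repr X).
by rewrite -[c *: _]L2clsZ -L2clsD !L2ip_cls l2ip_lin.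
Qed.

Lemma L2ip_herm Y Z : L2ip Y Z = (L2ip Z Y)^*.
Proof. exact: l2ip_herm. Qed.

Lemma L2ip_bilinear : bilinear_for *%R (Num.conj \; *%R) L2ip.
Proof.
split=> [Z c Y Y'|Y c Z Z'] /=; first exact: L2ip_lin.
by rewrite (semiip_linr L2ip_lin L2ip_herm).
Qed.

HB.instance Definition _ := bilinear_isBilinear.Build R[i] L2 L2 R[i]
  *%R (Num.conj \; *%R) L2ip L2ip_bilinear.

Fact L2ip_hermsym Y Z : L2ip Y Z = (-1) ^+ false * (L2ip Z Y)^*.
Proof. by rewrite expr0 mul1r -L2ip_herm. Qed.

HB.instance Definition _ := isHermitianSesquilinear.Build R[i] L2 false Num.conj
  L2ip L2ip_hermsym.

Lemma L2ip_ge0 Y : 0 <= L2ip Y Y.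
Proof. exact: l2ip_ge0. Qed.

Fact L2ip_gt0 Y : Y != 0 -> 0 < L2ip Y Y.
Proof.
move=> Y0; rewrite lt_def (l2ip_ge0 (repr Y)) andbT; apply: contra_neq Y0 => YN.
by rewrite -(L2cls_repr Y) -L2cls0; apply/L2clsP; rewrite subr0.
Qed.

HB.instance Definition _ := isDotProduct.Build R[i] L2 L2ip L2ip_gt0.

Definition L2norm (Y : L2) : R[i] := sqrtC (L2ip Y Y).

Fact ler_L2normD Y Z : L2norm (Y + Z) <= L2norm Y + L2norm Z.
Proof.
exact: (semiip_triangle L2ip_lin L2ip_herm L2ip_ge0).
Qed.

Fact L2normZ (c : R[i]) Y : L2norm (c *: Y) = `|c| * L2norm Y.
Proof.
exact: (semiip_normZ L2ip_lin L2ip_herm L2ip_ge0).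
Qed.

Fact L2norm0_eq0 Y : L2norm Y = 0 -> Y = 0.
Proof.
move=> /eqP; rewrite sqrtC_eq0 => /eqP YN; apply/eqP; apply: contraT => /L2ip_gt0.
by rewrite YN ltxx.
Qed.

HB.instance Definition _ := Lmodule_isNormed.Build R[i] L2
  ler_L2normD L2normZ L2norm0_eq0.

End WeightedSpace.

Arguments L2 {R n a b} w.
Arguments l2 {R n a b} w.

Section Relations.
Variables (R : realType) (n : nat) (a b : \bar int) (w : weight R n a b).
Implicit Types T S : set (L2 w * L2 w)%type.

Definition linear_relation T := GRing.submod_closed [in T].

Definition adjoint T : set (L2 w * L2 w)%type :=
  [set p | forall q, T q -> L2ip p.1 q.2 = L2ip p.2 q.1].

Definition dual_pair T S :=
  [/\ linear_relation T /\ closed T,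
      linear_relation S /\ closed S
    & forall p q, T p -> S q -> L2ip p.2 q.1 = L2ip p.1 q.2].

Definition symplmx : 'M[R[i]]_(n + n) := block_mx 0 (- 1%:M) 1%:M 0.

Definition coefmx (A B C D : int -> 'M[R[i]]_n) (t : int) : 'M[R[i]]_(n + n) :=
  block_mx (- C t) (D t) (A t) (B t).

Definition hamop (P : int -> 'M[R[i]]_(n + n)) (y : int -> 'cV[R[i]]_(n + n))
    (t : int) : 'cV[R[i]]_(n + n) :=
  symplmx *m (y (t + 1) - y t) - P t *m pshift y t.

Definition finsupp_seq : set (int -> 'cV[R[i]]_(n + n)) :=
  [set y | exists s k, [/\ zint a b s, zint a b k &
    forall t, zint a (b + 1) t -> (t <= s) || (k + 1 <= t) -> y t = 0]].

Definition solves P (y g : l2 w) :=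
  forall t, zint a b t -> hamop P (val y) t = weightmx w t *m pshift (val g) t.

Definition Hmax P : set (L2 w * L2 w)%type :=
  [set p | exists y g : l2 w, [/\ p.1 = L2cls y, p.2 = L2cls g & solves P y g]].

Definition Hpre P : set (L2 w * L2 w)%type :=
  [set p | Hmax P p /\ exists y g : l2 w,
    [/\ p.1 = L2cls y, p.2 = L2cls g, finsupp_seq (val y) & solves P y g]].

Definition Hmin P : set (L2 w * L2 w)%type := closure (Hpre P).

End Relations.

Arguments finsupp_seq {R n} a b y.
Arguments Hmax {R n a b} w P.
Arguments Hpre {R n a b} w P.
Arguments Hmin {R n a b} w P.

(* Main.v *)
(* By (A_1) each of the equations L_1 y = f and L_2 y = f is a two-sided
   first-order recursion with invertible coefficients, so initial value problems
   are solvable from any starting point.  The summed Lagrange identity for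
   x^* J z gives Hmax(P^* ) <= (Hpre P)^*.  Conversely, let (Y, G) be in the
   adjoint and let z solve L_2 z = W R(G).  If a finitely supported f is
   W-orthogonal to all homogeneous solutions psi of L_2, then L_1 x = W R(f) has a
   finitely supported solution x, whence f is W-orthogonal to Y - z.  As the
   space of the psi is finite-dimensional, a separation argument in C^(2n+1)
   gives Y - z = psi modulo W for some psi, so that z + psi represents Y and
   solves L_2 (z + psi) = W R(G). *)

Require Import Defs.
From HB Require Import structures.
From mathcomp Require Import all_boot all_order all_algebra.
From mathcomp Require Import spectral sesquilinear complex ring zify.
From mathcomp Require Import boolp classical_sets functions reals constructive_ereal.
From mathcomp Require Import ereal topology normedtype esum.

Set Implicit Arguments.
Unset Strict Implicit.
Unset Printing Implicit Defensive.

Import Order.TTheory GRing.Theory Num.Theory numFieldNormedType.Exports.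

Local Open Scope classical_set_scope.
Local Open Scope complex_scope.
Local Open Scope ring_scope.
Local Open Scope sesquilinear_scope.

(** * Two-sided recursion and induction over the integers *)

Lemma int_rec_ex (T : Type) (F G : int -> T -> T) :
    (forall t, cancel (G t) (F t)) -> forall (t0 : int) (x0 : T),
  exists y : int -> T, y t0 = x0 /\ forall t, y (t + 1) = F t (y t).
Proof.
move=> GK t0 x0.
(* [up m] is the value at [t0 + m] and [down m] the value at [t0 - m]. As [F t] undoes [G t], the
   forward rule also holds along the backward branch. *)
pose up := fix up m := if m is m'.+1 then F (t0 + m'%:Z) (up m') else x0.
pose down := fix down m :=
  if m is m'.+1 then G (t0 - m'.+1%:Z) (down m') else x0.
exists (fun t => match t - t0 with Posz m => up m | Negz m => down m.+1 end).
split=> [|t]; first by rewrite subrr.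
have -> : t + 1 - t0 = t - t0 + 1 by lia.
case E : (t - t0) => [m|m].
  have -> : Posz m + 1 = m.+1 by lia.
  by rewrite /= (_ : t0 + m%:Z = t) //; lia.
have -> : t = t0 - m.+1%:Z by lia.
rewrite [down m.+1]/= GK; case: m E => [|m] _ //.
by have -> : Negz m.+1 + 1 = Negz m by lia.
Qed.

Lemma int_ind_up (P : int -> Prop) (s : int) :
  P s -> (forall t, s <= t -> P t -> P (t + 1)) -> forall t, s <= t -> P t.
Proof.
move=> Ps IH t st; rewrite (_ : t = s + `|t - s|%N%:Z); last by lia.
elim: `|t - s|%N => [|m Pm]; first by rewrite addr0.
by rewrite intS addrCA addrC; apply: IH Pm; lia.
Qed.

Lemma int_ind_down (P : int -> Prop) (s : int) :
  P s -> (forall t, t < s -> P (t + 1) -> P t) -> forall t, t <= s -> P t.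
Proof.
move=> Ps IH t st; rewrite (_ : t = s - `|t - s|%N%:Z); last by lia.
elim: `|t - s|%N => [|m Pm]; first by rewrite subr0.
have E : s - m.+1%:Z + 1 = s - m%:Z by lia.
by apply: IH; [lia|rewrite E].
Qed.

(** * Separating a row vector from a subspace *)

Section SubspaceSeparation.
Variables (K : fieldType) (m : nat) (S : set 'rV[K]_m).
Hypotheses (S0 : S 0) (S_lin : forall c u v, S u -> S v -> S (c *: u + v)).

Lemma subspace_row_span k (X : 'M[K]_(k, m)) (v : 'rV_m) :
  (forall i, S (row i X)) -> (v <= X)%MS -> S v.
Proof.
move=> SX /submxP[u ->]; rewrite mulmx_sum_row.
elim/big_ind: _ => // [x y Sx Sy|i _].
  by rewrite -[x]scale1r; exact: S_lin.
by rewrite -[_ *: _]addr0; exact: S_lin.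
Qed.

(** Among the matrices with all rows in [S], one of maximal rank spans [S]: adjoining a vector of
    [S] outside its row space would raise the rank. *)
Lemma subspace_mx : exists X : 'M[K]_m, forall v : 'rV_m, S v <-> (v <= X)%MS.
Proof.
pose Q r := `[< exists2 X : 'M[K]_m, forall i, S (row i X) & \rank X = r >].
have exQ : exists r, Q r.
  by exists 0%N; apply/asboolP; exists 0; rewrite ?mxrank0 // => i; rewrite row0.
have ubQ r : Q r -> (r <= m)%N by case/asboolP=> X _ <-; exact: rank_leq_col.
have [_ /asboolP[X SX <-] maxX] := ex_maxnP exQ ubQ.
exists X => v; split=> [Sv|]; last exact: subspace_row_span.
have := maxX (\rank (X + v)%MS); have -> : Q (\rank (X + v)%MS).
  apply/asboolP; exists (X + v)%MS => // i.
  apply: (@subspace_row_span _ (col_mx X v)) => [j|].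
    case: (splitP j) => l E.
      by rewrite (_ : j = lshift _ l) ?rowKu //; exact: val_inj.
    by rewrite (_ : j = rshift _ l) ?rowKd ?row_id //; exact: val_inj.
  by rewrite (submx_trans (row_sub i _)) // addsmxE.
move=> /(_ isT) le_rank; have := mxrank_leqif_sup (addsmxSl X v).
move=> [_]; rewrite eqn_leq le_rank mxrankS ?addsmxSl //.
by move=> /esym; apply: submx_trans; exact: addsmxSr.
Qed.

(** The columns of [cokermx X] together cut out the row space of [X], so one of them does not
    annihilate [v0]; it is rescaled to take the value 1 there. *)
Lemma subspace_separation (v0 : 'rV[K]_m) : ~ S v0 ->
  exists d : 'cV[K]_m, (forall v, S v -> v *m d = 0) /\ v0 *m d = 1%:M.
Proof.
move=> Sv0; have [X SX] := subspace_mx.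
have : ~~ (v0 <= X)%MS by apply/negP => /SX.
rewrite submxE; set c := v0 *m _ => /eqP/matrixP/existsNP[i /existsNP[j]].
rewrite ord1 [X in _ <> X]mxE => /eqP c0.
exists ((c 0 j)^-1 *: col j (cokermx X)); split.
  move=> v /SX; rewrite submxE => /eqP vX; rewrite -scalemxAr colE mulmxA vX.
  by rewrite mul0mx scaler0.
rewrite -scalemxAr colE mulmxA -/c -colE.
by clearbody c; apply/matrixP => k l; rewrite !ord1 !mxE mulVf.
Qed.

End SubspaceSeparation.

(** * The operator as a first-order recursion, and Lagrange's identity *)

Section HamiltonianOperator.
Variables (R : realType) (n : nat).
Local Notation seqs := (int -> 'cV[R[i]]_(n + n)).

(** The partial shift reads the upper half at [t + 1] and the lower half at [t]. Hence [A] and [C]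
    go with [y (t + 1)], while [B] and [D] go with [y t] in [cur_coef]. *)
Definition next_coef (A C : int -> 'M[R[i]]_n) (t : int) : 'M[R[i]]_(n + n) :=
  block_mx (C t) (- 1%:M) (1%:M - A t) 0.

Definition cur_coef (B D : int -> 'M[R[i]]_n) (t : int) : 'M[R[i]]_(n + n) :=
  block_mx 0 (D t - 1%:M) 1%:M (B t).

Lemma hamop_step A B C D (y : seqs) t :
  hamop (coefmx A B C D) y t =
  next_coef A C t *m y (t + 1) - cur_coef B D t *m y t.
Proof.
rewrite /hamop /pshift /symplmx /coefmx /next_coef /cur_coef.
rewrite -[y (t + 1)]vsubmxK -[y t]vsubmxK !col_mxKu !col_mxKd.
move: (usubmx (y (t + 1))) (dsubmx (y (t + 1))) => u' v'.
move: (usubmx (y t)) (dsubmx (y t)) => u v.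
rewrite opp_col_mx add_col_mx !mul_block_col !opp_col_mx !add_col_mx.
rewrite !mul0mx !mul1mx !mulNmx !mul1mx !mulmxBl !mul1mx !add0r !addr0.
congr col_mx; apply/matrixP => i j; rewrite ![in LHS]mxE ![in RHS]mxE;
  rewrite ?[(_ *m _) i j]lock; ring.
Qed.

(** The matrix is block anti-triangular with anti-diagonal blocks [-I] and [I - A t], which yields
    an explicit left inverse. *)
Lemma next_coef_unit A C t :
  1%:M - A t \in unitmx -> next_coef A C t \in unitmx.
Proof.
move=> A1.
pose V := invmx (1%:M - A t).
have : block_mx 0 V (- 1%:M) (C t *m V) *m next_coef A C t = 1%:M.
  rewrite /next_coef mulmx_block !mul0mx !mulmx0 !mulNmx !mul1mx -mulmxA mulVmx //.
  by rewrite mulmx1 opprK addNr !add0r addr0 -scalar_mx_block.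
by case/mulmx1_unit.
Qed.

Lemma cur_coef_unit B D t :
  1%:M - D t \in unitmx -> cur_coef B D t \in unitmx.
Proof.
move=> D1.
pose V := invmx (D t - 1%:M).
have D1' : D t - 1%:M \in unitmx by rewrite -opprB -scaleN1r unitmxZ ?unitrN1.
have : block_mx (- (B t *m V)) 1%:M V 0 *m cur_coef B D t = 1%:M.
  rewrite /cur_coef mulmx_block !mul0mx !mulmx0 !mul1mx !mulNmx -mulmxA mulVmx //.
  by rewrite mulmx1 addNr !add0r addr0 -scalar_mx_block.
by case/mulmx1_unit.
Qed.

Lemma adjmxD m k (M N : 'M[R[i]]_(m, k)) : (M + N)^t* = M^t* + N^t*.
Proof. by rewrite linearD map_mxD. Qed.

Lemma adjmxN m k (M : 'M[R[i]]_(m, k)) : (- M)^t* = - M^t*.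
Proof. by rewrite linearN map_mxN. Qed.

Lemma symplmx_adj : (symplmx R n)^t* = - symplmx R n.
Proof.
rewrite /symplmx tr_block_mx map_block_mx opp_block_mx !linear0 !map_mx0.
by rewrite adjmxN trmx1 map_mx1 opprK.
Qed.

Lemma symplmx_col (u v p q : 'cV[R[i]]_n) :
  (col_mx u v)^t* *m symplmx R n *m col_mx p q = v^t* *m p - u^t* *m q.
Proof.
rewrite tr_col_mx map_row_mx mul_row_block mul_row_col.
by rewrite !mulmx0 !mulmx1 mulmxN mulmx1 add0r addr0 mulNmx.
Qed.

(** The terms in [P] cancel because the second operator carries the conjugate transpose; what
    remains is a discrete product rule for [x^* J z]. *)
Lemma lagrange (P : int -> 'M[R[i]]_(n + n)) (x z : seqs) t :
  (pshift x t)^t* *m hamop (fun t => (P t)^t*) z t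
    - (hamop P x t)^t* *m pshift z t =
  (x (t + 1))^t* *m symplmx R n *m z (t + 1) - (x t)^t* *m symplmx R n *m z t.
Proof.
rewrite /hamop !adjmxD adjmxN [(P t *m _)^t*]trmxCE mulmxBr mulmxBl.
rewrite [_ *m (_ *m pshift z t)]mulmxA opprB addrA subrK.
rewrite trmxCE symplmx_adj mulmxN mulNmx opprK mulmxA.
rewrite /pshift.
rewrite -[x (t + 1)]vsubmxK -[x t]vsubmxK -[z (t + 1)]vsubmxK -[z t]vsubmxK.
rewrite !col_mxKu !col_mxKd.
move: (usubmx (x (t + 1))) (dsubmx (x (t + 1))) => u' v'.
move: (usubmx (x t)) (dsubmx (x t)) => u v.
move: (usubmx (z (t + 1))) (dsubmx (z (t + 1))) => p' q'.
move: (usubmx (z t)) (dsubmx (z t)) => p q.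
rewrite !opp_col_mx !add_col_mx !symplmx_col !adjmxD !adjmxN.
rewrite !mulmxDr !mulmxDl !mulmxN !mulNmx.
apply/matrixP => i j; rewrite !ord1 {i j}.
(* Only six scalar products occur. The mixed ones, [u'^* q] and [v^* p'], cancel: this is why the
   shift treats the two halves differently. *)
move: (u'^t* *m q') (u'^t* *m q) (v^t* *m p') (v^t* *m p) (v'^t* *m p')
  (u^t* *m q) => a1 a2 a3 a4 a5 a6.
rewrite !mxE; ring.
Qed.
End HamiltonianOperator.

(** * Unconditional sums with finitely many nonzero terms *)

Section FiniteSupportSums.
Variables (R : realType) (T : choiceType) (I : set T).

Lemma rsum_single (g : T -> R) t0 : I t0 ->
    (forall t, I t -> t != t0 -> g t = 0) ->
  rsummable I g /\ rsum I g = g t0.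
Proof.
move=> It0 g0.
have esum_single (h : T -> R) : (forall t, I t -> t != t0 -> h t = 0) ->
    0 <= h t0 -> esum I (EFin \o h) = (h t0)%:E.
  move=> h0 hpos; rewrite (esumID [set t0]); last first.
    move=> t It /=; rewrite lee_fin.
    by have [->|/(h0 _ It) ->] := eqVneq t t0.
  rewrite (_ : I `&` [set t0] = [set t0]); last first.
    by apply/seteqP; split=> [t []|t /= ->].
  rewrite esum_set1 /= ?lee_fin // esum1 ?adde0 // => t [It /eqP tt0].
  by rewrite /= h0.
have gs : rsummable I g.
  rewrite /rsummable /summable.
  rewrite (@eq_esum _ _ _ _ (EFin \o (fun t => `|g t|))) //.
  by rewrite esum_single ?ltry // => t It tt0; rewrite g0 ?normr0.
split=> //.
have pos (h : T -> R) : rsummable I h -> (forall t, I t -> t != t0 -> h t = 0) ->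
    0 <= h t0 -> rsum I h = h t0.
  move=> hs h0 hpos; rewrite rsum_pos // ?esum_single // => t It.
  by have [->|/(h0 _ It) ->] := eqVneq t t0.
(* The sum is defined through positive and negative parts; a negative value is reduced to a
   nonnegative one by passing to [- g]. *)
have [gpos|/ltW gneg] := leP 0 (g t0); first exact: pos.
apply: oppr_inj; rewrite -rsumN //; apply: pos.
- by move: gs; rewrite /rsummable summableN.
- by move=> t It tt0; rewrite g0 ?oppr0.
- by rewrite oppr_ge0.
Qed.

Lemma csum_single (g : T -> R[i]) t0 : I t0 ->
    (forall t, I t -> t != t0 -> g t = 0) ->
  csummable I g /\ csum I g = g t0.
Proof.
move=> It0 g0.
have [|sr er] := @rsum_single (fun t => complex.Re (g t)) t0 It0.
  by move=> t It tt0; rewrite g0.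
have [|si ei] := @rsum_single (fun t => complex.Im (g t)) t0 It0.
  by move=> t It tt0; rewrite g0.
by split; [split|rewrite /csum er ei; case: (g t0)].
Qed.

Lemma csum_finite (r : seq T) (g : T -> R[i]) : uniq r ->
    (forall t, t \in r -> I t) -> (forall t, I t -> t \notin r -> g t = 0) ->
  csummable I g /\ csum I g = \sum_(t <- r) g t.
Proof.
elim: r g => [|x r IHr] g /=.
  move=> _ _ g0.
  have zs : rsummable I (fun=> 0 : R).
    by rewrite /rsummable /summable esum1 // => t _; rewrite /= normr0.
  have zE : rsum I (fun=> 0 : R) = 0 by rewrite rsum_pos // esum1.
  split.
    by split; apply: eq_rsummable zs => t It; rewrite g0.
  rewrite big_nil (@eq_csum _ _ _ _ (fun=> 0)) ?/csum ?zE // => t It.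
  exact: g0.
move=> /andP[xr ur] rI g0.
pose g1 t := if t == x then g t else 0.
pose g2 t := if t == x then 0 else g t.
have [||s1 e1] := @csum_single g1 x.
- by apply: rI; rewrite mem_head.
- by move=> t It /negPf tx; rewrite /g1 tx.
have [||s2 e2] := IHr g2 ur.
- by move=> t tr; apply: rI; rewrite in_cons tr orbT.
- move=> t It tr; rewrite /g2; case: eqVneq => // tx.
  by apply: g0; rewrite // in_cons negb_or tx.
have gE : g = fun t => g1 t + g2 t.
  by apply/funext => t; rewrite /g1 /g2; case: eqP; rewrite ?addr0 ?add0r.
split; first by rewrite gE; exact: csummableD.
rewrite [in LHS]gE csumD // e1 e2 big_cons /g1 eqxx; congr (_ + _).
apply: eq_big_seq => t tr; rewrite /g2; case: eqVneq => // tx.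
by rewrite -tx tr in xr.
Qed.

End FiniteSupportSums.

(** This puts the sum in the consecutive form to which telescoping applies. *)
Lemma csum_window (R : realType) (I : set int) (g : int -> R[i])
    (s : int) (N : nat) :
    (forall i, (i <= N)%N -> I (s + i%:Z)) ->
    (forall t, I t -> (t < s) || (s + N%:Z < t) -> g t = 0) ->
  csummable I g /\ csum I g = \sum_(0 <= i < N.+1) g (s + i%:Z).
Proof.
move=> sI g0; pose r := [seq s + i%:Z | i <- index_iota 0 N.+1].
have ur : uniq r by rewrite map_inj_uniq ?iota_uniq // => i j /addrI [].
have [||sg eg] := csum_finite ur (I := I) (g := g).
- by move=> t /mapP[j]; rewrite mem_index_iota => /andP[_ jN] ->; exact: sI.
- move=> t It tr; apply: g0 => //; apply: contraR tr => tsN; apply/mapP.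
  by exists `|t - s|%N; rewrite ?mem_index_iota; lia.
by split=> //; rewrite eg big_map.
Qed.

(** * Linear recursions with invertible coefficients *)

Section Recursion.
Variables (F : fieldType) (m p : nat) (K L : int -> 'M[F]_m).
Hypotheses (Ku : forall t, K t \in unitmx) (Lu : forall t, L t \in unitmx).
Implicit Types h y : int -> 'M[F]_(m, p).

(** Inverting [K t] gives the forward step, inverting [L t] the backward one. *)
Lemma recursion_ex h t0 (x0 : 'M_(m, p)) : exists y,
  y t0 = x0 /\ forall t, K t *m y (t + 1) - L t *m y t = h t.
Proof.
pose up t x := invmx (K t) *m (L t *m x + h t).
pose down t x := invmx (L t) *m (K t *m x - h t).
have [t x /=|y [y0 yS]] := @int_rec_ex 'M[F]_(m, p) up down _ t0 x0.
  by rewrite /up /down mulKVmx // subrK mulKmx.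
by exists y; split=> // t; rewrite yS /up mulKVmx // addrAC subrr add0r.
Qed.

Lemma recursion_zero_up y s :
    (forall t, s <= t -> K t *m y (t + 1) - L t *m y t = 0) -> y s = 0 ->
  forall t, s <= t -> y t = 0.
Proof.
move=> yS ys; apply: int_ind_up => // t st yt.
have := yS t st; rewrite yt mulmx0 subr0.
by move/(congr1 (mulmx (invmx (K t)))); rewrite mulKmx // mulmx0.
Qed.

Lemma recursion_zero_down y s :
    (forall t, t < s -> K t *m y (t + 1) - L t *m y t = 0) -> y s = 0 ->
  forall t, t <= s -> y t = 0.
Proof.
move=> yS ys; apply: int_ind_down => // t st yt.
have := yS t st; rewrite yt mulmx0 sub0r => /eqP; rewrite oppr_eq0 => /eqP.
by move/(congr1 (mulmx (invmx (L t)))); rewrite mulKmx // mulmx0.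
Qed.

End Recursion.

(** Since [K t *m Psi (t + 1) = L t *m Psi t], invertibility spreads in both directions from
    [Psi 0 = 1]. *)
Lemma fundamental_solution_ex (F : fieldType) (m : nat) (K L : int -> 'M[F]_m) :
    (forall t, K t \in unitmx) -> (forall t, L t \in unitmx) ->
  exists Psi : int -> 'M[F]_m, (forall t, Psi t \in unitmx) /\
    forall t, K t *m Psi (t + 1) - L t *m Psi t = 0.
Proof.
move=> Ku Lu; have [Psi [Psi0 PsiS]] := recursion_ex Ku Lu (fun=> 0) 0 1%:M.
have step t : K t *m Psi (t + 1) = L t *m Psi t by apply/eqP; rewrite -subr_eq0 PsiS.
have unit_step t : (Psi (t + 1) \in unitmx) = (Psi t \in unitmx).
  have := congr1 (fun M => M \in unitmx) (step t).
  by rewrite /= !unitmx_mul Ku Lu.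
exists Psi; split=> // t; have [t0|/ltW t0] := leP 0 t.
  by elim/int_ind_up: t0 => [|t' _]; rewrite ?unit_step // Psi0 unitmx1.
by elim/int_ind_down: t0 => [|t' _]; rewrite ?unit_step // Psi0 unitmx1.
Qed.

(** * Integer intervals with possibly infinite ends *)

Section IntegerIntervals.
Implicit Types (a b : \bar int) (s t k : int).

Lemma zint_convex a b s k t : zint a b s -> zint a b k -> s <= t <= k -> zint a b t.
Proof.
move=> /andP[sa _] /andP[_ kb] /andP[st tk]; apply/andP; split.
  by apply: le_trans sa _; rewrite lee_fin.
by apply: le_trans kb; rewrite lee_fin.
Qed.

(** Sequences live on the interval prolonged by one point, and the operator at [t] reads them at [t]
    and [t + 1]. *)
Lemma zint_widen a b t : zint a b t -> zint a (b + 1) t /\ zint a (b + 1) (t + 1).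
Proof.
rewrite /zint /=; case: a b => [a||] [b||] //=;
  rewrite ?leey ?leNye ?leeNy_eq ?andbT ?andbF //=; rewrite -?EFinD ?lee_fin; lia.
Qed.

Lemma zint_nonempty a b : (a < +oo)%E -> (-oo < b)%E -> (a + 1 <= b)%E ->
  exists t, zint a b t.
Proof.
rewrite /zint /=; case: a b => [a||] [b||] //= _ _; rewrite -?EFinD ?lee_fin => ab.
- by exists a; rewrite !lee_fin; lia.
- by exists a; rewrite lee_fin lexx leey.
- by exists b; rewrite leNye lee_fin lexx.
- by exists 0; rewrite leNye leey.
Qed.

End IntegerIntervals.

(** * Finitely supported sequences and Green's formula *)

Section Adjoint.
Variables (R : realType) (n : nat) (a b : \bar int) (w : weight R n a b).
Local Notation I := (zint a b).
Local Notation seqs := (int -> 'cV[R[i]]_(n + n)).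
Local Notation coefs := (int -> 'M[R[i]]_(n + n)).

Lemma wform_linr c (y f g : seqs) t :
  wform w y (c *: f + g) t = c^* * wform w y f t + wform w y g t.
Proof.
rewrite /wform pshift_lin adjmxD !mulmxDl mxE; congr (_ + _).
by rewrite linearZ map_mxZ -!scalemxAl mxE.
Qed.

Lemma hamop_lin (P : coefs) c (u v : seqs) t :
  hamop P (c *: u + v) t = c *: hamop P u t + hamop P v t.
Proof.
rewrite /hamop pshift_lin.
have -> : (c *: u + v) (t + 1) - (c *: u + v) t =
    c *: (u (t + 1) - u t) + (v (t + 1) - v t).
  by rewrite scalerBr opprD addrACA.
move: (u (t + 1) - u t) (v (t + 1) - v t) (pshift u t) (pshift v t) => p q r s.
rewrite [symplmx R n *m _]mulmxDr [P t *m _]mulmxDr -!scalemxAr.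
by rewrite scalerBr opprD addrACA.
Qed.

(** Moving the upper half back by one step inverts the partial shift, so test sequences can be
    prescribed by their shifted values. *)
Lemma pshift_surj (F : seqs) : exists f : seqs, forall t, pshift f t = F t.
Proof.
exists (fun t => col_mx (usubmx (F (t - 1))) (dsubmx (F t))) => t.
by rewrite /pshift col_mxKu col_mxKd addrK vsubmxK.
Qed.

(** The condition bears on shifted values, the only ones [wform] reads, and on all integers outside
    the window, to match recursions run over the whole of [int]. *)
Definition window_supp (f : seqs) : Prop := exists s k, [/\ I s, I k, s <= k &
  forall t, (t < s) || (k < t) -> pshift f t = 0].

Lemma wform_window_csum (g f : seqs) : window_supp f -> csummable I (wform w g f).
Proof.
move=> [s [k [Is Ik sk f0]]].
have [||//] := @csum_window R I (wform w g f) s `|k - s|%N.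
  by move=> j jN; apply: zint_convex Is Ik _; lia.
move=> t It ts; rewrite /wform f0; last by lia.
by rewrite trmx0 map_mx0 !mul0mx mxE.
Qed.

Lemma window_supp_l2W f : window_supp f -> f \in l2W w.
Proof. by move=> fs; apply/l2WE; have [] := wform_window_csum f fs. Qed.

Lemma window_supp_lin c f g :
  window_supp f -> window_supp g -> window_supp (c *: f + g).
Proof.
move=> [s [k [Is Ik sk f0]]] [s' [k' [Is' Ik' sk' g0]]].
exists (Num.min s s'), (Num.max k k'); split.
- by rewrite minEle; case: ifP.
- by rewrite maxEle; case: ifP.
- by lia.
- by move=> t ts; rewrite pshift_lin f0 ?g0 ?scaler0 ?addr0 //; lia.
Qed.

Lemma lagrange_sum (P : coefs) (x z : seqs) s N :
  \sum_(0 <= j < N.+1)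
    ((pshift x (s + j%:Z))^t* *m hamop (fun t => (P t)^t*) z (s + j%:Z)) 0 0 -
  \sum_(0 <= j < N.+1)
    ((hamop P x (s + j%:Z))^t* *m pshift z (s + j%:Z)) 0 0 =
  ((x (s + N.+1%:Z))^t* *m symplmx R n *m z (s + N.+1%:Z)) 0 0
    - ((x s)^t* *m symplmx R n *m z s) 0 0.
Proof.
pose B (j : nat) :=
  ((x (s + j%:Z))^t* *m symplmx R n *m z (s + j%:Z)) 0 0.
have <- : B 0%N = ((x s)^t* *m symplmx R n *m z s) 0 0 by rewrite /B addr0.
rewrite -[RHS]/(B N.+1 - B 0%N) -telescope_sumr // -sumrB.
apply: eq_bigr => j _; rewrite /B (_ : s + j.+1%:Z = s + j%:Z + 1); last by lia.
have := lagrange P x z (s + j%:Z) => /matrixP/(_ 0 0).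
by rewrite [in LHS]mxE [in X in _ + X]mxE [in RHS]mxE [in X in _ = _ + X]mxE.
Qed.

Lemma wform_hamop_l (P : coefs) (x f z : seqs) t : I t ->
    hamop P x t = weightmx w t *m pshift f t ->
  ((hamop P x t)^t* *m pshift z t) 0 0 = wform w z f t.
Proof. by move=> It ->; rewrite /wform trmxCE weightmx_herm. Qed.

(** Both sides reduce to sums over a window containing the support of [x]; their difference is the
    boundary term of Lagrange's identity, zero since [x] vanishes at both ends. *)
Lemma green (P : coefs) (x f z g : seqs) : finsupp_seq a b x ->
    (forall t, I t -> hamop P x t = weightmx w t *m pshift f t) ->
    (forall t, I t ->
       hamop (fun t => (P t)^t*) z t = weightmx w t *m pshift g t) ->
  csum I (wform w z f) = csum I (wform w g x).
Proof.
move=> [s [k0 [Is Ik0 x0]]] xf zg.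
(* If [k0 < s], then [x] is zero throughout; the maximum keeps the window nonempty in that case
   too. *)
pose k := Num.max s k0; pose N := `|k - s|%N.
have Ik : I k by rewrite /k maxEle; case: ifP.
have sI j : (j <= N)%N -> I (s + j%:Z).
  by move=> jN; apply: zint_convex Is Ik _; lia.
have px t : I t -> (t < s) || (s + N%:Z < t) -> pshift x t = 0.
  move=> It ts; have [It0 It1] := zint_widen It.
  by rewrite /pshift !x0 ?linear0 ?col_mx0 //; lia.
have hx t : I t -> (t < s) || (s + N%:Z < t) -> hamop P x t = 0.
  move=> It ts; have [It0 It1] := zint_widen It.
  by rewrite /hamop px // !x0 ?subrr ?mulmx0 ?subr0 //; lia.
have [|_ ->] := csum_window sI (g := wform w z f).
  move=> t It ts; rewrite -(wform_hamop_l z It (xf t It)) hx //.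
  by rewrite trmx0 map_mx0 mul0mx mxE.
have [|_ ->] := csum_window sI (g := wform w g x).
  by move=> t It ts; rewrite /wform px // trmx0 map_mx0 !mul0mx mxE.
apply/esym/eqP; rewrite -subr_eq0; apply/eqP.
have := lagrange_sum P x z s N.
(* The right boundary point [k + 1] may be [b + 1], hence the prolonged interval. *)
have [_ Is1] := zint_widen (sI N (leqnn _)); have [Is0 _] := zint_widen Is.
have -> : x s = 0 by apply: x0; rewrite ?lexx.
have -> : x (s + N.+1%:Z) = 0.
  by rewrite (_ : s + N.+1%:Z = s + N%:Z + 1); [apply: x0 => //|]; lia.
rewrite trmx0 map_mx0 !mul0mx mxE subr0 => E; rewrite -[RHS]E; congr (_ - _).
  apply: eq_big_nat => j /andP[_ jN]; have Ij := sI _ jN.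
  by rewrite zg // /wform mulmxA.
apply: eq_big_nat => j /andP[_ jN]; have Ij := sI _ jN.
by rewrite (wform_hamop_l z Ij (xf _ Ij)).
Qed.
End Adjoint.

(** * The adjoint of the pre-minimal relation *)

Section AdjointOfPreminimal.
Variables (R : realType) (n : nat) (a b : \bar int) (w : weight R n a b).
Local Notation I := (zint a b).
Local Notation seqs := (int -> 'cV[R[i]]_(n + n)).
Local Notation coefs := (int -> 'M[R[i]]_(n + n)).

(* Invertibility is asked at all integers, not only in the interval (outside of
   which it costs nothing), so that the recursion runs over the whole of int. *)
Definition regular_coef (P : coefs) : Prop :=
  exists K L : coefs, [/\ forall t, K t \in unitmx, forall t, L t \in unitmx &
    forall (y : seqs) t, I t ->
      hamop P y t = K t *m y (t + 1) - L t *m y t].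

Lemma coefmx_regular (A B C D : int -> 'M[R[i]]_n) :
    (forall t, I t -> (1%:M - A t \in unitmx) /\ (1%:M - D t \in unitmx)) ->
  regular_coef (coefmx A B C D).
Proof.
move=> AD; exists (fun t => if `[< I t >] then next_coef A C t else 1%:M).
exists (fun t => if `[< I t >] then cur_coef B D t else 1%:M); split=> [t|t|y t It].
- by case: asboolP => [/AD[A1 _]|_]; rewrite ?unitmx1 ?next_coef_unit.
- by case: asboolP => [/AD[_ D1]|_]; rewrite ?unitmx1 ?cur_coef_unit.
- by rewrite hamop_step asboolT.
Qed.

Lemma symplmx_unit : symplmx R n \in unitmx.
Proof.
have : - symplmx R n *m symplmx R n = 1%:M.
  rewrite /symplmx opp_block_mx mulmx_block !oppr0 !mul0mx !mulmx0.
  by rewrite opprK mul1mx mulNmx mul1mx opprK !addr0 !add0r -scalar_mx_block.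
by case/mulmx1_unit.
Qed.

(** The [psi j] are the columns of a fundamental matrix; the second property is its invertibility at
    each [t], in the form that forces a boundary vector to vanish. *)
Lemma homogeneous_basis (P : coefs) : regular_coef P ->
  exists psi : 'I_(n + n) -> seqs,
  (forall j t, I t -> hamop P (psi j) t = 0) /\
  forall t (v : 'rV[R[i]]_(n + n)), (forall j, v *m psi j t = 0) -> v = 0.
Proof.
move=> [K [L [Ku Lu hP]]]; have [Psi [Psiu PsiS]] := fundamental_solution_ex Ku Lu.
exists (fun j t => col j (Psi t)); split=> [j t It|t v vPsi].
  by rewrite hP // !colE !mulmxA -mulmxBl PsiS mul0mx.
have : v *m Psi t = 0.
  apply/matrixP => k j; rewrite ord1 [RHS]mxE; have := vPsi j.
  by rewrite colE mulmxA -colE => /matrixP/(_ 0 0); rewrite !mxE.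
by move/(congr1 (mulmx^~ (invmx (Psi t)))); rewrite /= mulmxK // mul0mx.
Qed.

Lemma inhomogeneous_ex (P : coefs) (g : seqs) : regular_coef P ->
  exists z : seqs, forall t, I t -> hamop P z t = g t.
Proof.
move=> [K [L [Ku Lu hP]]]; have [z [_ zS]] := recursion_ex Ku Lu g 0 0.
by exists z => t It; rewrite hP.
Qed.

(* By Lagrange's identity, orthogonality of [f] to the homogeneous solutions of
   the adjoint system makes the solution started from 0 on the left of the
   window of [f] return to 0 on its right. *)
Lemma finsupp_solution_ex (P : coefs) (psi : 'I_(n + n) -> seqs) (f : seqs) :
    regular_coef P ->
    (forall j t, I t -> hamop (fun t => (P t)^t*) (psi j) t = 0) ->
    (forall t (v : 'rV[R[i]]_(n + n)), (forall j, v *m psi j t = 0) -> v = 0) ->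
    window_supp a b f -> (forall j, csum I (wform w (psi j) f) = 0) ->
  exists x, [/\ window_supp a b x, finsupp_seq a b x &
    forall t, I t -> hamop P x t = weightmx w t *m pshift f t].
Proof.
move=> [K [L [Ku Lu hP]]] psiS psi_sep [s [k [Is Ik sk f0]]] f_orth.
have [x [xs xS]] := recursion_ex Ku Lu (fun t => weightmx w t *m pshift f t) s 0.
have xf t : I t -> hamop P x t = weightmx w t *m pshift f t by move=> It; rewrite hP.
have x_left t : t <= s -> x t = 0.
  apply: (recursion_zero_down (K := K) Lu _ xs) => t' ts.
  by rewrite xS f0 ?mulmx0 // ts.
have [N kE] : exists N : nat, k = s + N%:Z by exists `|k - s|%N; lia.
have sI j : (j <= N)%N -> I (s + j%:Z).
  by move=> jN; apply: zint_convex Is Ik _; lia.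
have xk : x (k + 1) = 0.
  (* As [J] is invertible, it suffices that [x(k+1)^* J] annihilates every [psi j (k + 1)];
     Lagrange's identity over the window turns this into the orthogonality of [f]. *)
  suff v0 : (x (k + 1))^t* *m symplmx R n = 0.
    have : (x (k + 1))^t* = 0 by rewrite -(mulmxK symplmx_unit (_ ^t*)) v0 mul0mx.
    by move/(congr1 (fun M => M^t*)); rewrite trmxCK trmx0 map_mx0.
  apply: (psi_sep (k + 1)) => j.
  have := lagrange_sum P x (psi j) s N.
  rewrite big_nat big1 => [|i /andP[_ iN]]; last first.
    by rewrite psiS ?mulmx0 ?mxE //; exact: sI.
  have [|_ fE] := csum_window sI (g := wform w (psi j) f).
    by move=> t It ts; rewrite /wform f0 ?kE // trmx0 map_mx0 !mul0mx mxE.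
  rewrite (eq_big_nat _ _ (F2 := fun i => wform w (psi j) f (s + i%:Z))); last first.
    move=> i /andP[_ iN]; have Ii := sI _ iN.
    by rewrite (wform_hamop_l _ Ii (xf _ Ii)).
  rewrite -fE f_orth subr0 xs trmx0 map_mx0 !mul0mx [(0 : 'M_1) _ _]mxE subr0.
  rewrite (_ : s + N.+1%:Z = k + 1); last by lia.
  by move=> e; apply/matrixP => i l; rewrite !ord1 -e mxE.
have x_right t : k + 1 <= t -> x t = 0.
  apply: (recursion_zero_up (L := L) Ku _ xk) => t' kt.
  by rewrite xS f0 ?mulmx0 //; lia.
exists x; split=> //.
  exists s, k; split=> // t ts; rewrite /pshift.
  have [x0 x1] : x t = 0 /\ x (t + 1) = 0.
    by case/orP: ts => ts; split; do ?[apply: x_left; lia]; apply: x_right; lia.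
  by rewrite x0 x1 !linear0 col_mx0.
by exists s, k; split=> // t _ /orP[/x_left|/x_right].
Qed.

Lemma csum_wform_linr (y : seqs) c f g : window_supp a b f -> window_supp a b g ->
  csum I (wform w y (c *: f + g)) =
  c^* * csum I (wform w y f) + csum I (wform w y g).
Proof.
move=> fs gs; have [yf yg] := (wform_window_csum w y fs, wform_window_csum w y gs).
rewrite -(csumZ _ yf) -(csumD (csummableZ _ yf) yg).
by apply: eq_csum => t It; exact: wform_linr.
Qed.

Lemma csum_wform_linl c (y z f : seqs) : window_supp a b f ->
  csum I (wform w (c *: y + z) f) =
  c * csum I (wform w y f) + csum I (wform w z f).
Proof.
move=> fs; have [yf zf] := (wform_window_csum w y fs, wform_window_csum w z fs).
rewrite -(csumZ _ yf) -(csumD (csummableZ _ yf) zf).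
by apply: eq_csum => t It; exact: wform_lin.
Qed.

Lemma csum_wform_suml m (c : 'I_m -> R[i]) (y : 'I_m -> seqs) f :
    window_supp a b f ->
  csum I (wform w (\sum_j c j *: y j) f) = \sum_j c j * csum I (wform w (y j) f).
Proof.
move=> fs; elim: m c y => [|m IHm] c y.
  rewrite !big_ord0; have := csum_wform_linl (-1) 0 0 fs.
  by rewrite scaler0 addr0 mulN1r addNr.
by rewrite !big_ord_recl csum_wform_linl // IHm.
Qed.

(** Testing with sequences whose shifted value is a unit vector at [t0] and zero elsewhere isolates
    each entry of [W R(y)] at [t0]. *)
Lemma weightmx_null (y : seqs) t0 : I t0 ->
    (forall f, window_supp a b f -> csum I (wform w y f) = 0) ->
  weightmx w t0 *m pshift y t0 = 0.
Proof.
move=> It0 y0; apply/matrixP => i j; rewrite ord1 {j} [RHS]mxE.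
have [f fE] := pshift_surj
  (fun t => if t == t0 then delta_mx i 0 else 0 : 'cV[R[i]]_(n + n)).
have f0 t : t != t0 -> pshift f t = 0 by rewrite fE => /negPf ->.
have fs : window_supp a b f.
  by exists t0, t0; split=> // t tt0; apply: f0; lia.
have [|_] := csum_single (g := wform w y f) It0.
  by move=> t _ tt0; rewrite /wform f0 // trmx0 map_mx0 !mul0mx mxE.
rewrite y0 // /wform fE eqxx trmx_delta map_delta_mx -mulmxA -rowE.
by rewrite [in RHS]mxE => <-.
Qed.

(** Send [f] to its products with [r] and all [phi j]. By hypothesis the vector (1, 0, ..., 0) is
    not attained; a functional vanishing on the attained subspace and equal to 1 at this vector
    supplies the coefficients. *)
Lemma window_separation m (phi : 'I_m -> seqs) (r : seqs) : (exists t, I t) ->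
    (forall f, window_supp a b f ->
       (forall j, csum I (wform w (phi j) f) = 0) -> csum I (wform w r f) = 0) ->
  exists c : 'I_m -> R[i], forall t, I t ->
    weightmx w t *m pshift (r + \sum_j c j *: phi j) t = 0.
Proof.
move=> [t0 It0] phir.
pose phi' i := oapp phi r (unlift ord0 i).
have phi'0 : phi' ord0 = r by rewrite /phi' unlift_none.
have phi'S j : phi' (lift ord0 j) = phi j by rewrite /phi' liftK.
have [Lam LamE] : exists Lam : seqs -> 'rV[R[i]]_m.+1,
    forall f i, Lam f 0 i = csum I (wform w (phi' i) f).
  by exists (fun f => \row_i csum I (wform w (phi' i) f)) => f i; rewrite mxE.
pose S : set 'rV[R[i]]_m.+1 := [set v | exists2 f, window_supp a b f & v = Lam f].
have supp0 : window_supp a b (0 : seqs).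
  by exists t0, t0; split=> // t _; rewrite /pshift !linear0 col_mx0.
have Lam_lin c f f' : window_supp a b f -> window_supp a b f' ->
    Lam (c *: f + f') = c^* *: Lam f + Lam f'.
  move=> fs fs'; apply/rowP => i.
  have linE e (u v : 'rV[R[i]]_m.+1) : (e *: u + v) 0 i = e * u 0 i + v 0 i.
    by rewrite !mxE.
  by rewrite linE (LamE (_ *: _ + _)) (LamE f) (LamE f') csum_wform_linr.
have S0 : S 0.
  exists 0 => //; have := Lam_lin (-1) _ _ supp0 supp0.
  by rewrite scaler0 addr0 rmorphN1 scaleN1r addNr.
have S_lin c u v : S u -> S v -> S (c *: u + v).
  (* The products are conjugate-linear in [f], hence the conjugated scalar. *)
  move=> [f fs ->] [f' fs' ->]; exists (c^* *: f + f').
    exact: window_supp_lin.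
  by rewrite (Lam_lin _ _ _ fs fs') conjCK.
have [|d [Sd d1]] := subspace_separation S0 S_lin (v0 := delta_mx 0 ord0).
  move=> [f fs fE].
  have Lf i : csum I (wform w (phi' i) f) = (delta_mx 0 ord0 : 'rV[R[i]]_m.+1) 0 i.
    by rewrite fE LamE.
  have : csum I (wform w r f) = 0.
    by apply: phir fs _ => j; rewrite -phi'S Lf mxE.
  by rewrite -phi'0 Lf mxE => /eqP; rewrite oner_eq0.
have d01 : d ord0 0 = 1.
  by move: d1; rewrite -rowE => /matrixP/(_ 0 0); rewrite !mxE.
exists (fun j => d (lift ord0 j) 0) => t It.
have -> : r + \sum_j d (lift ord0 j) 0 *: phi j = \sum_i d i 0 *: phi' i.
  rewrite big_ord_recl d01 scale1r phi'0; congr (_ + _).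
  by apply: eq_bigr => j _; rewrite phi'S.
apply: weightmx_null => // f fs; rewrite csum_wform_suml //.
have /matrixP/(_ 0 0) := Sd _ (ex_intro2 _ _ f fs erefl).
rewrite [LHS]mxE [RHS]mxE => LfE; rewrite -[RHS]LfE.
by apply: eq_bigr => k _; rewrite mulrC LamE.
Qed.

Lemma L2cls_eq (y z : l2 w) :
    (forall t, I t -> weightmx w t *m pshift (val y - val z) t = 0) ->
  L2cls y = L2cls z.
Proof.
move=> yz; apply/L2clsP.
have [//|//|t It _|_] :=
  @csum_finite R _ I [::] (wform w (val y - val z) (val y - val z)).
  by rewrite /wform -mulmxA yz // mulmx0 mxE.
by rewrite big_nil.
Qed.

Lemma adjoint_preminimal_sub (P : coefs) :
    (exists t, I t) -> regular_coef P -> regular_coef (fun t => (P t)^t*) ->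
  adjoint (Hpre w P) `<=` Hmax w (fun t => (P t)^t*).
Proof.
move=> I0 regP regPs [Y G] YG.
pose y0 : l2 w := repr Y; pose g0 : l2 w := repr G.
have [z zg] := inhomogeneous_ex (fun t => weightmx w t *m pshift (val g0) t) regPs.
have [psi [psiS psi_sep]] := homogeneous_basis regPs.
have [//|f fs fpsi|c cE] := window_separation (phi := psi) (r := val y0 - z).
  (* With [x] solving the first equation for [f], both [y0] and [z] have product with [f] equal to
     that of [g0] with [x]: for [y0] by membership in the adjoint, for [z] by Green's formula. *)
  have [x [xs xfin xf]] := finsupp_solution_ex regP psiS psi_sep fs fpsi.
  pose xl : l2 w := Sub x (window_supp_l2W w xs).
  pose fl : l2 w := Sub f (window_supp_l2W w fs).
  have y0g0 : l2ip y0 fl = l2ip g0 xl.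
    rewrite -!L2ip_cls !L2cls_repr; apply: (YG (L2cls xl, L2cls fl)).
    by split; exists xl, fl.
  rewrite -scaleN1r addrC csum_wform_linl // (green xfin xf zg) mulN1r.
  by apply/eqP; rewrite addrC subr_eq0; apply/eqP.
pose h : seqs := \sum_j c j *: psi j.
have hS t : I t -> hamop (fun t => (P t)^t*) h t = 0.
  move=> It.
  have hamop0 : hamop (fun t => (P t)^t*) 0 t = 0.
    have := hamop_lin (fun t => (P t)^t*) (-1) 0 0 t.
    by rewrite scaler0 addr0 scaleN1r addNr.
  rewrite /h; elim/big_ind: _ => [//|u v u0 v0|j _].
    by rewrite -[u]scale1r hamop_lin u0 v0 scaler0 addr0.
  by rewrite -[_ *: _]addr0 hamop_lin psiS // hamop0 scaler0 addr0.
pose y : seqs := z - h.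
have Wy t : I t -> weightmx w t *m pshift y t = weightmx w t *m pshift (val y0) t.
  move=> It; apply/eqP; rewrite eq_sym -subr_eq0 -mulmxBr; apply/eqP.
  rewrite -[RHS](cE t It); congr (_ *m _).
  have -> : val y0 - z + \sum_j c j *: psi j = -1 *: y + val y0.
    by rewrite /y scaleN1r opprB addrC addrA [RHS]addrAC addrC addrA.
  by rewrite pshift_lin scaleN1r addrC.
(* Square summability of [z] and [h] is not known separately; that of [y] follows because [wform]
   depends on [y] only through [W R(y)], which agrees with that of [y0]. *)
have yy t : I t -> wform w y y t = wform w (val y0) (val y0) t.
  move=> It; have wE u : wform w y u t = wform w (val y0) u t.
    by rewrite /wform -!mulmxA Wy.
  by rewrite wE wform_herm // wE -wform_herm.
have yl2 : y \in l2W w.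
  apply/l2WE; have /l2WE := valP y0; apply: eq_rsummable => t It.
  by rewrite yy.
pose yl : l2 w := Sub y yl2.
have yS : solves (fun t => (P t)^t*) yl g0.
  move=> t It; rewrite -[RHS](zg t It).
  have -> : val yl = -1 *: h + z by rewrite scaleN1r addrC.
  by rewrite hamop_lin hS // scaler0 add0r.
exists yl, g0; split=> //=; last by rewrite L2cls_repr.
rewrite -[LHS]L2cls_repr; apply: L2cls_eq => t It.
have -> : val (repr Y) - val yl = -1 *: y + val y0 by rewrite scaleN1r addrC.
by rewrite pshift_lin mulmxDr -scalemxAr Wy // scaleN1r addNr.
Qed.

Lemma max_sub_adjoint_preminimal (P : coefs) :
  Hmax w (fun t => (P t)^t*) `<=` adjoint (Hpre w P).
Proof.
move=> [Y G] [y [g [/= -> -> yg]]] [X F] [_ [x [f [/= -> -> xfin xf]]]].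
by rewrite !L2ip_cls; exact: green xfin xf yg.
Qed.
End AdjointOfPreminimal.

(** * Closures of relations and their adjoints *)

Lemma closure_submod (K : numFieldType) (V : normedModType K) (T : set V) :
  GRing.submod_closed [in T] -> GRing.submod_closed [in closure T].
Proof.
move=> [T0 T_lin]; split=> [|c p q].
  by rewrite inE; apply: subset_closure; move: T0; rewrite inE.
rewrite !inE => Tp Tq B Bpq.
(* Continuity of the combination gives neighbourhoods of [p] and [q] mapped into [B], and each of
   them meets [T]. *)
have : (fun z : V * V => c *: z.1 + z.2) @ (p, q) --> c *: p + q.
  apply: cvgD; last exact: cvg_snd.
  by apply: cvgZr; exact: cvg_fst.
move=> /(_ _ Bpq)[[A1 A2] [/= A1p A2q] sub].
have [p' [Tp' A1p']] := Tp _ A1p; have [q' [Tq' A2q']] := Tq _ A2q.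
exists (c *: p' + q'); split; last exact: (sub (p', q')).
by have := T_lin c p' q'; rewrite !inE => /(_ Tp' Tq').
Qed.

Section ClosureOfRelation.
Variables (R : realType) (n : nat) (a b : \bar int) (w : weight R n a b).
Implicit Types T : set (L2 w * L2 w).

Lemma L2ip_CS (X Y : L2 w) : `|L2ip X Y| <= `|X| * `|Y|.
Proof.
rewrite -[`|X|]/(L2norm X) -[`|Y|]/(L2norm Y) -ler_sqr.
- rewrite exprMn !sqrtCK; apply: semiip_CS.
  + exact: L2ip_lin.
  + exact: L2ip_herm.
  + exact: L2ip_ge0.
- by rewrite nnegrE.
- by rewrite nnegrE mulr_ge0 // sqrtC_ge0 L2ip_ge0.
Qed.

Lemma L2ip_subr (X Y Z : L2 w) : L2ip X (Y - Z) = L2ip X Y - L2ip X Z.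
Proof.
have := semiip_linr (@L2ip_lin _ _ _ _ w) (@L2ip_herm _ _ _ _ w) (-1) X Z Y.
by rewrite scaleN1r addrC => ->; rewrite rmorphN1 mulN1r addrC.
Qed.

(** For fixed [p] the defining identity is continuous in [q] by Cauchy-Schwarz, so it passes from
    [T] to its closure. *)
Lemma adjoint_closure T : adjoint (closure T) = adjoint T.
Proof.
apply/seteqP; split=> [p pT q Tq|p pT q Tq]; first exact/pT/subset_closure.
apply/eqP; rewrite -subr_eq0 -normr_le0; apply/ler_addgt0Pl => e e0; rewrite addr0.
(* If [q'] is within [e / M] of [q] in both components, the defect is at most
   [(|p.1| + |p.2|) e / M], hence at most [e]; the summand 1 makes [M] positive. *)
pose M := `|p.1| + `|p.2| + 1.
have M0 : 0 < M by rewrite ltr_wpDl ?addr_ge0.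
have eM : 0 < e / M by rewrite divr_gt0.
have [q' [Tq' [q1 q2]]] := Tq _ (nbhsx_ballx q (e / M) eM).
move: q1 q2; rewrite -!ball_normE /= => q1 q2.
have -> : L2ip p.1 q.2 - L2ip p.2 q.1 =
    L2ip p.1 (q.2 - q'.2) - L2ip p.2 (q.1 - q'.1).
  by rewrite !L2ip_subr (pT _ Tq') opprB addrA subrK.
apply: le_trans (ler_normB _ _) _; rewrite -[e](divfK (lt0r_neq0 M0)) mulrC.
rewrite /M 2!mulrDl mul1r -addrA; apply: lerD.
  by apply: le_trans (L2ip_CS _ _) _; apply: ler_wpM2l => //; exact: ltW.
apply: le_trans (L2ip_CS _ _) _; apply: ler_wpDr; first exact: ltW.
by apply: ler_wpM2l => //; exact: ltW.
Qed.

Lemma Hpre_submod P : (exists t, zint a b t) -> linear_relation (Hpre w P).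
Proof.
move=> [t0 It0].
have solves_lin c (y g y' g' : l2 w) : solves P y g -> solves P y' g' ->
    solves P (c *: y + y') (c *: g + g').
  move=> yg yg' t It; rewrite hamop_lin pshift_lin mulmxDr -scalemxAr.
  by rewrite yg // yg'.
have finsupp_lin c (y y' : int -> 'cV[R[i]]_(n + n)) :
    finsupp_seq a b y -> finsupp_seq a b y' -> finsupp_seq a b (c *: y + y').
  move=> [s [k [Is Ik y0]]] [s' [k' [Is' Ik' y0']]].
  exists (Num.min s s'), (Num.max k k'); split.
  - by rewrite minEle; case: ifP.
  - by rewrite maxEle; case: ifP.
  - move=> t It ts; have -> : (c *: y + y') t = c *: y t + y' t by [].
    by rewrite y0 ?y0' ?scaler0 ?addr0 //; lia.
split=> [|c p q]; rewrite !inE.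
  have solves0 : solves P (0 : l2 w) 0.
    move=> t It; have := hamop_lin P (-1) 0 0 t.
    rewrite scaler0 addr0 scaleN1r addNr => hamop0; rewrite [LHS]hamop0.
    by rewrite /pshift !linear0 col_mx0 mulmx0.
  have cls0 : (0 : L2 w) = L2cls 0 by rewrite L2cls0.
  split; first by exists 0, 0.
  (* Finite support asks for points of the interval, even for the zero sequence. *)
  by exists 0, 0; split=> //; exists t0, t0.
move=> [_ [y [g [pE1 pE2 ys yg]]]] [_ [y' [g' [qE1 qE2 ys' yg']]]].
have clsE e (u v : l2 w) : L2cls (e *: u + v) = e *: L2cls u + L2cls v.
  by rewrite L2clsD L2clsZ.
have E1 : (c *: p + q).1 = L2cls (c *: y + y') by rewrite clsE -pE1 -qE1.
have E2 : (c *: p + q).2 = L2cls (c *: g + g') by rewrite clsE -pE2 -qE2.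
have sol := solves_lin c _ _ _ _ yg yg'.
split; first by exists (c *: y + y'), (c *: g + g').
by exists (c *: y + y'), (c *: g + g'); split=> //; exact: finsupp_lin.
Qed.
End ClosureOfRelation.

(** * Conjugate transposes of the coefficients, and the theorem *)

Lemma coefmx_adj (R : realType) n (A B C D : int -> 'M[R[i]]_n) :
  (fun t => (coefmx A B C D t)^t*) =
  coefmx (fun t => (D t)^t*) (fun t => (B t)^t*) (fun t => (C t)^t*)
    (fun t => (A t)^t*).
Proof.
apply/funext => t; rewrite /coefmx tr_block_mx map_block_mx.
by rewrite adjmxN.
Qed.

Theorem theorem3p2 (R : realType) (n : nat) (a b : \bar int)
    (a_fin : (a < +oo)%E) (b_fin : (-oo < b)%E) (ab : (a + 1 <= b)%E)
    (w : weight R n a b) (A B C D : int -> 'M[R[i]]_n)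
    (A1 : forall t, zint a b t ->
       (1%:M - A t \in unitmx) /\ (1%:M - D t \in unitmx)) :
  let P1 := coefmx A B C D in
  let P2 := fun t => (P1 t)^t* in
  [/\ Hmax w P2 = adjoint (Hmin w P1),
      Hmax w P1 = adjoint (Hmin w P2)
    & dual_pair (Hmin w P1) (Hmin w P2)].
Proof.
move=> P1 P2.
have I0 := zint_nonempty a_fin b_fin ab.
have reg1 : regular_coef a b P1 by apply: coefmx_regular.
have reg2 : regular_coef a b P2.
  (* The conjugate transpose exchanges the roles of [A] and [D], and the assumption on them is
     symmetric under this exchange. *)
  rewrite /P2 coefmx_adj; apply: coefmx_regular => t /A1[uA uD].
  have adj_unit (M : 'M[R[i]]_n) : 1%:M - M \in unitmx -> 1%:M - M^t* \in unitmx.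
    move=> uM; have -> : 1%:M - M^t* = (1%:M - M)^t*.
      by rewrite adjmxD adjmxN trmx1 map_mx1.
    by rewrite map_unitmx unitmx_tr.
  by split; exact: adj_unit.
(* The second identity is thus the first with [P1] and [P2] exchanged. *)
have P2K : (fun t => (P2 t)^t*) = P1 by apply/funext => t; rewrite /P2 trmxCK.
have E2 : Hmax w P2 = adjoint (Hmin w P1).
  rewrite adjoint_closure; apply/seteqP; split.
    exact: max_sub_adjoint_preminimal.
  exact: adjoint_preminimal_sub.
have E1 : Hmax w P1 = adjoint (Hmin w P2).
  rewrite adjoint_closure; apply/seteqP; split; rewrite -P2K.
    exact: max_sub_adjoint_preminimal.
  by apply: adjoint_preminimal_sub => //; rewrite P2K.
split=> //; split.
- by split; [exact/closure_submod/Hpre_submod|exact: closed_closure].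
- by split; [exact/closure_submod/Hpre_submod|exact: closed_closure].
(* By continuity, pairs [r] of the pre-minimal relation of [P2] suffice. They lie in [Hmax w P2],
   the adjoint of [Hmin w P1], and Hermitian symmetry reverses the identity. *)
move=> p q Hp Hq; suff : adjoint (Hmin w P2) p by move=> /(_ _ Hq) ->.
rewrite adjoint_closure => r [Hr _]; rewrite L2ip_herm [RHS]L2ip_herm.
by move: Hr; rewrite E2 => /(_ _ Hp) ->.
Qed.
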